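(* Let $E$ be a normalized symmetric Banach sequence space, let $G$ be a group and let $\rho \colon G \to \mathrm{Aut}^+(E)$ be a positive representation. Then $E$ splits into band irreducibles, in the sense that there exists an $\alpha$ with $1 \leq \alpha \leq \infty$ such that the set of invariant and band irreducible bands $\{B_n\}_{1 \leq n \leq \alpha}$ (if $\alpha < \infty$) or $\{B_n\}_{1 \leq n < \infty}$ (if $\alpha = \infty$) satisfies \[ x = \sum_{n=1}^\alpha P_n x \quad \text{for all } x \in E, \] where $P_n \colon E \to B_n$ denotes the band projection, and the series is unconditionally order convergent, hence, in the case that $E$ has order continuous norm, unconditionally convergent. Moreover, if $\rho$ has compact image (in the strong operator topology) and $E$ has order continuous norm or $E = \ell^\infty$, then every invariant and band irreducible band is finite dimensional, and so $\alpha = \infty$.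
   Context: A normalized symmetric Banach sequence space is a Banach lattice $E$ of real sequences (indexed by $\mathbb{N}$), with the pointwise ordering and lattice operations, such that: if $x\in E$ and $y$ is a sequence with $|y|\le|x|$, then $y\in E$ and $\|y\|\le\|x\|$; permutations of sequences in $E$ remain in $E$ with the same norm; and the standard unit vectors $e_n$ ($n\in\mathbb{N}$) have norm $1$. $\mathrm{Aut}^+(E)$ is the group of lattice automorphisms of $E$. A positive representation of $G$ in $E$ is a group homomorphism $\rho\colon G\to\mathrm{Aut}^+(E)$. A band $B\subset E$ is invariant if $\rho(s)B\subset B$ for all $s\in G$; an invariant band $B$ is band irreducible if the only invariant bands contained in $B$ are $\{0\}$ and $B$ (equivalently, the restricted representation in $B$ has only trivial invariant bands); the zero band is not counted among the irreducible bands. The $B_n$ are listed without repetition. A series $\sum_{n=1}^\infty x_n$ in a Riesz space is unconditionally order convergent to $x$ if $\sum_{n=1}^\infty x_{\sigma(n)}$ converges in order to $x$ for every permutation $\sigma$ of $\mathbb{N}$; ''unconditionally convergent'' refers to norm convergence. *)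

(* Defs.v *)
From HB Require Import structures.
From mathcomp Require Import all_boot all_order all_algebra.
From mathcomp Require Import all_classical all_reals all_analysis.

Set Implicit Arguments.
Unset Strict Implicit.
Unset Printing Implicit Defensive.

Import Order.TTheory GRing.Theory Num.Theory.
Import numFieldNormedType.Exports.

Local Open Scope classical_set_scope.
Local Open Scope ring_scope.

Definition unit_seq (R : realType) (n : nat) : nat -> R := fun i => (i == n)%:R.

(* The norm is a total function on sequences: only its values on the carrier
   are constrained. *)
Record symSeqSpace (R : realType) := SymSeqSpace {
  carrier : {pred nat -> R};
  seqnorm : (nat -> R) -> R;
  carrier_submod : submod_closed carrier;
  seqnorm_triangle : forall x y, x \in carrier -> y \in carrier ->
    seqnorm (x + y) <= seqnorm x + seqnorm y;
  seqnormZ : forall (a : R) x, x \in carrier ->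
    seqnorm (a *: x) = `|a| * seqnorm x;
  seqnorm_eq0 : forall x, x \in carrier -> seqnorm x = 0 -> x = 0;
  seqnorm_complete : forall u : nat -> nat -> R,
    (forall n, u n \in carrier) ->
    (forall e, 0 < e -> exists N : nat, forall m n : nat,
       (N <= m)%N -> (N <= n)%N -> seqnorm (u m - u n) < e) ->
    exists2 l, l \in carrier &
      forall e, 0 < e -> exists N : nat, forall n : nat,
        (N <= n)%N -> seqnorm (l - u n) < e;
  carrier_solid : forall x y : nat -> R, x \in carrier ->
    (forall i, `|y i| <= `|x i|) -> y \in carrier /\ seqnorm y <= seqnorm x;
  carrier_symmetric : forall (x : nat -> R) (s : nat -> nat), bijective s ->
    x \in carrier -> x \o s \in carrier /\ seqnorm (x \o s) = seqnorm x;
  unit_seq_norm : forall n,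
    unit_seq R n \in carrier /\ seqnorm (unit_seq R n) = 1
}.

Record elt (R : realType) (E : symSeqSpace R) := Elt {
  seq_of_elt :> nat -> R;
  _ : seq_of_elt \in carrier E }.

Coercion elt : symSeqSpace >-> Sortclass.

Section instances.
Variables (R : realType) (E : symSeqSpace R).

HB.instance Definition _ := [isSub of elt E for @seq_of_elt R E].
HB.instance Definition _ := [Choice of elt E by <:].

HB.instance Definition _ := GRing.isSubmodClosed.Build R (nat -> R) (carrier E)
  (carrier_submod E).
HB.instance Definition _ := [SubChoice_isSubLmodule of elt E by <:].

Let nrm (x : elt E) : R := seqnorm E x.

Let nrmD x y : nrm (x + y) <= nrm x + nrm y.
Proof. exact: seqnorm_triangle (valP x) (valP y). Qed.

Let nrmZ (a : R) x : nrm (a *: x) = `|a| * nrm x.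
Proof. exact: seqnormZ (valP x). Qed.

Let nrm_eq0 x : nrm x = 0 -> x = 0.
Proof. by move=> /(seqnorm_eq0 (valP x)) x0; exact: val_inj. Qed.

HB.instance Definition _ := Lmodule_isNormed.Build R (elt E) nrmD nrmZ nrm_eq0.

Let nrm_complete (F : set_system (elt E)) :
  ProperFilter F -> cauchy F -> cvg F.
Proof.
move=> FF /cauchyP Fc.
have Fx n : {x : elt E | F (ball x n.+1%:R^-1)}.
  by apply: cid; apply: Fc; rewrite invr_gt0.
pose u n := sval (Fx n).
have uP n : F (ball (u n) n.+1%:R^-1) := svalP (Fx n).
have small (e : R) : 0 < e -> exists N : nat, forall n : nat, (N <= n)%N ->
    n.+1%:R^-1 < e.
  move=> e0; exists (Num.truncn e^-1).+1 => n Nn.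
  rewrite invf_plt ?posrE//; apply: lt_le_trans (truncnS_gt _) _.
  by rewrite ler_nat (leq_trans Nn).
have [] := @seqnorm_complete _ E (fun n => u n : nat -> R).
- by move=> n; exact: valP.
- move=> e e0; have [N NP] := small _ (divr_gt0 e0 (ltr0Sn _ 1)).
  exists N => m n Nm Nn; rewrite -[ltLHS]/(`|u m - u n|).
  have [y [my ny]] := filter_ex (filterI (uP m) (uP n)).
  rewrite -(subrKA y) (le_lt_trans (ler_normD _ _))// (splitr e).
  move: my ny; rewrite -!ball_normE /ball_/= [`|u n - y|]distrC => my ny.
  by rewrite ltrD// ?(lt_trans my (NP _ Nm)) ?(lt_trans ny (NP _ Nn)).
- move=> l lE lP; apply/cvg_ex; exists (Elt lE).
  apply/cvgrPdist_lt => e e0.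
  have [N NP] := small _ (divr_gt0 e0 (ltr0Sn _ 1)).
  have [M MP] := lP _ (divr_gt0 e0 (ltr0Sn _ 1)).
  pose n := maxn N M; apply: filterS (uP n) => y.
  rewrite -ball_normE /ball_/= => ny.
  rewrite -(subrKA (u n)) (le_lt_trans (ler_normD _ _))// (splitr e).
  rewrite ltrD//; first exact: MP (leq_maxr _ _).
  by rewrite (lt_trans ny)// NP// leq_maxl.
Qed.

HB.instance Definition _ := Uniform_isComplete.Build (elt E) nrm_complete.

Let carrier_abs (x y : nat -> R) : x \in carrier E -> y \in carrier E ->
  (fun i => `|x i| + `|y i|) \in carrier E.
Proof.
move=> xE yE; have H z : z \in carrier E -> (fun i => `|z i|) \in carrier E.
  by move=> /(@carrier_solid _ E) h; apply: (h _ _).1 => i; rewrite normr_id.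
exact: rpredD (H _ xE) (H _ yE).
Qed.

Let carrier_meet : {in carrier E &, forall x y, (x `&` y)%O \in carrier E}.
Proof.
move=> x y xE yE; apply: (carrier_solid (carrier_abs xE yE) _).1 => i.
rewrite meetfE [leRHS]ger0_norm ?addr_ge0//.
by case: (leP (x i) (y i)) => _; rewrite ?lerDl ?lerDr.
Qed.

Let carrier_join : {in carrier E &, forall x y, (x `|` y)%O \in carrier E}.
Proof.
move=> x y xE yE; apply: (carrier_solid (carrier_abs xE yE) _).1 => i.
rewrite joinfE [leRHS]ger0_norm ?addr_ge0//.
by case: (leP (x i) (y i)) => _; rewrite ?lerDl ?lerDr.
Qed.

HB.instance Definition _ := Order.isMeetLatticeClosed.Build _ _ (carrier E)
  carrier_meet.
HB.instance Definition _ := Order.isJoinLatticeClosed.Build _ _ (carrier E)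
  carrier_join.
HB.instance Definition _ := [SubChoice_isSubLattice of elt E by <: with FunOrder.fun_display].

Lemma elt_normE (x : elt E) : `|x| = seqnorm E x.
Proof. by []. Qed.

Lemma elt_leP (x y : elt E) : reflect (forall i, x i <= y i) (x <= y)%O.
Proof. exact: lefP. Qed.

Lemma elt_joinE (x y : elt E) i : (x `|` y)%O i = Num.max (x i) (y i).
Proof. exact: joinEtotal. Qed.

Lemma elt_meetE (x y : elt E) i : (x `&` y)%O i = Num.min (x i) (y i).
Proof. exact: meetEtotal. Qed.

End instances.

Section riesz.
Variables (R : realType) (E : symSeqSpace R).
Implicit Types (x y : E) (B D : set E).

Definition vabs x : E := (x `|` - x)%O.

Lemma vabsE x i : vabs x i = `|x i|.
Proof. by rewrite elt_joinE real_maxrN ?num_real. Qed.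

Definition order_ideal B :=
  [/\ B 0, forall (a : R) x y, B x -> B y -> B (a *: x + y)
    & forall x y, B x -> (vabs y <= vabs x)%O -> B y].

Definition band B :=
  order_ideal B /\ forall D x, D `<=` B -> supremums D x -> B x.

Definition disjoint_compl B : set E :=
  [set y | forall x, B x -> (vabs x `&` vabs y)%O = 0].

Definition band_projection B (P : E -> E) :=
  forall x, B (P x) /\ disjoint_compl B (x - P x).

Definition finite_dimensional B :=
  exists (n : nat) (b : 'I_n -> E), (forall i, B (b i)) /\
    forall x, B x -> exists c : 'I_n -> R, x = \sum_i c i *: b i.

Definition order_cvg (u : nat -> E) x :=
  exists z : nat -> E,
    [/\ forall m n : nat, (m <= n)%N -> (z n <= z m)%O,
        infimums (range z) 0
      & forall n, (vabs (u n - x) <= z n)%O].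

Definition unconditionally_order_cvg (u : nat -> E) x :=
  forall s : nat -> nat, bijective s -> order_cvg (series (u \o s)) x.

Definition unconditionally_cvg (u : nat -> E) x :=
  forall s : nat -> nat, bijective s -> series (u \o s) @ \oo --> x.

Definition order_continuous_norm :=
  forall (I : Type) (leI : I -> I -> Prop) (x : I -> E),
    inhabited I ->
    (forall i, leI i i) ->
    (forall i j k, leI i j -> leI j k -> leI i k) ->
    (forall i j, exists k, leI i k /\ leI j k) ->
    (forall i j, leI i j -> (x j <= x i)%O) ->
    infimums (range x) 0 ->
    forall e : R, 0 < e -> exists i, forall j, leI i j -> `|x j| < e.

Definition is_ellinfty :=
  (forall x : nat -> R,
     x \in carrier E <-> has_ubound (range (fun i => `|x i|))) /\
  (forall x : E, `|x| = sup (range (fun i => `|x i|))).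

Definition lattice_automorphism (T : E -> E) :=
  [/\ linear T, bijective T, {morph T : x y / (x `|` y)%O}
    & {morph T : x y / (x `&` y)%O}].

Variable G : groupType.

Definition positive_representation (rho : G -> E -> E) :=
  (forall s, lattice_automorphism (rho s)) /\
  (forall s t, rho (s * t)%g = rho s \o rho t).

Variable rho : G -> E -> E.

Definition invariant_band B := band B /\ forall s x, B x -> B (rho s x).

Definition band_irreducible B :=
  [/\ invariant_band B, B <> [set 0]
    & forall B', invariant_band B' -> B' `<=` B -> B' = [set 0] \/ B' = B].

(* The strong operator topology is the topology of pointwise convergence for
   the norm. *)
Definition sot_compact_image := compact (range rho : set {ptws E -> E}).

End riesz.

(* The indices of a family {B_n}_{n < alpha}, with [None] standing for
   alpha = oo; the numbering starts at 0. *)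
Definition below (alpha : option nat) : set nat :=
  [set n | if alpha is Some a then (n < a)%N else true].

(* Main.v *)
(* A lattice automorphism maps atoms to atoms, hence acts on coordinates by a
   permutation of N together with positive weights.  Bands of E correspond to
   subsets of N, invariant bands to unions of orbits of the induced action of G
   on N, and irreducible bands to single orbits, so that the decomposition is
   the partition of N into orbits.  When the image of G is compact, so is
   {rho s e_n | s}; as it misses 0, it meets only finitely many of the
   coordinate half-axes, and the orbit of n is finite. *)
Require Import Defs.
From HB Require Import structures.
From mathcomp Require Import all_boot all_order all_algebra.
From mathcomp Require Import finmap.
From mathcomp Require Import all_classical all_reals all_analysis.

Import Order.TTheory GRing.Theory Num.Theory.
Import numFieldNormedType.Exports.

Local Open Scope classical_set_scope.
Local Open Scope ring_scope.

(** * Coordinates, unit vectors and restrictions of sequences *)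

Section coordinates.
Context {R : realType} {E : symSeqSpace R}.
Implicit Types (x y z : E) (A : set nat) (B : set E) (T : E -> E).

Lemma elt_ext x y : (forall i, x i = y i) -> x = y.
Proof. by move=> xy; apply: val_inj; apply/funext. Qed.

Lemma eltD x y i : (x + y) i = x i + y i. Proof. by []. Qed.

Lemma eltN x i : (- x) i = - x i. Proof. by []. Qed.

Lemma eltZ (a : R) x i : (a *: x) i = a * x i. Proof. by []. Qed.

Lemma elt0 i : (0 : E) i = 0. Proof. by []. Qed.

Lemma elt_sum (I : Type) (r : seq I) (P : pred I) (F : I -> E) i :
  (\sum_(k <- r | P k) F k) i = \sum_(k <- r | P k) F k i.
Proof. exact: (big_morph (fun x : E => x i)). Qed.

Definition unit_elt n : E := Elt (unit_seq_norm E n).1.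

Lemma unit_eltE n i : unit_elt n i = (i == n)%:R. Proof. by []. Qed.

Lemma unit_elt_neq0 n : unit_elt n <> 0.
Proof.
move=> /(congr1 (fun x : E => x n)); rewrite unit_eltE elt0 eqxx.
by apply/eqP; rewrite oner_eq0.
Qed.

Lemma le_elt_norm x y : (forall i, `|x i| <= `|y i|) -> `|x| <= `|y|.
Proof. by move=> xy; rewrite !elt_normE; exact: (carrier_solid (valP y) xy).2. Qed.

Lemma normr_unit_elt n : `|unit_elt n| = 1.
Proof. exact: (unit_seq_norm E n).2. Qed.

(** By solidity, since [x i *: unit_elt i] lies below [x] in modulus and unit vectors have norm 1.
    Coordinates are thus 1-Lipschitz. *)
Lemma coord_le_norm x i : `|x i| <= `|x|.
Proof.
have -> : `|x i| = `|x i *: unit_elt i| by rewrite normrZ normr_unit_elt mulr1.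
apply: le_elt_norm => j; rewrite eltZ unit_eltE.
by case: eqP => [->|_]; rewrite ?mulr1// mulr0 normr0.
Qed.

Lemma restr_carrier A x : patch (fun=> 0) A x \in carrier E.
Proof.
apply: (carrier_solid (valP x) _).1 => i; rewrite /patch.
by case: ifP; rewrite ?normr0.
Qed.

Definition restr A x : E := Elt (restr_carrier A x).

Lemma restrE A x i : restr A x i = if i \in A then x i else 0.
Proof. by []. Qed.

Lemma restrT A x i : A i -> restr A x i = x i.
Proof. by move=> Ai; rewrite /= /patch mem_set. Qed.

Lemma restrF A x i : ~ A i -> restr A x i = 0.
Proof. by move=> Ai; rewrite /= /patch memNset. Qed.

(** * Bands and subsets of the index set *)

Definition supp_band A : set E := [set x | forall i, ~ A i -> x i = 0].

Lemma supp_band_unit {A n} : A n -> supp_band A (unit_elt n).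
Proof. by move=> An i Ai; rewrite unit_eltE; case: eqP => // ni; rewrite ni in Ai. Qed.

Lemma supp_band_unitP {A n} : supp_band A (unit_elt n) <-> A n.
Proof.
split=> [AB|]; last exact: supp_band_unit.
apply: contrapT => /AB; rewrite unit_eltE eqxx.
by apply/eqP; rewrite oner_eq0.
Qed.

Lemma band_supp_band A : band (supp_band A).
Proof.
split; first split.
- by [].
- by move=> a x y Ax Ay i Ai; rewrite eltD eltZ Ax// Ay// mulr0 addr0.
- move=> x y Ax /elt_leP yx i Ai; move: (yx i); rewrite !vabsE Ax// normr0.
  by rewrite normr_le0 => /eqP.
- move=> D x DA [ubx lubx] i Ai.
  have xi0 : x i <= 0.
    (* All members of [D] vanish at [i], so [x] with its [i]-th coordinate set to 0 is still an
       upper bound. *)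
    pose x' : E := restr (~` [set i]) x.
    have ubx' : ubound D x'.
      move=> d Dd; apply/elt_leP => j.
      have [->|ji] := pselect (j = i); last by rewrite restrT//; apply/elt_leP/ubx.
      by rewrite restrF ?(DA d)//; exact.
    by have /elt_leP/(_ i) := lubx _ ubx'; rewrite restrF//; exact.
  have [[d Dd]|D0] := pselect (D !=set0).
    apply/eqP; rewrite eq_le xi0/= -(DA d Dd i Ai).
    by apply/elt_leP/ubx.
  (* For empty [D] every element is an upper bound, and a supremum would be a least element of [E],
     which does not exist. *)
  have /elt_leP/(_ i) : (x <= x - unit_elt i)%O.
    by apply: lubx => d Dd; case: D0; exists d.
  by rewrite eltD eltN unit_eltE eqxx lerDl oppr_ge0 ler10.
Qed.

Lemma sum_unit_elt n x : \sum_(i < n) x i *: unit_elt i = restr `I_n x.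
Proof.
apply: elt_ext => j; rewrite elt_sum.
under eq_bigr => i _ do rewrite eltZ unit_eltE.
have [jn|nj] := ltnP j n; last first.
  rewrite restrF /=; last by rewrite ltnNge nj.
  rewrite big1// => i _; case: eqP => [ji|_]; last by rewrite mulr0.
  by move: (ltn_ord i); rewrite -ji ltnNge nj.
rewrite restrT// (bigD1 (Ordinal jn))//= eqxx mulr1 big1 ?addr0// => i ij.
case: eqP => [ji|_]; last by rewrite mulr0.
by case/eqP: ij; apply/val_inj.
Qed.

Lemma order_idealZ B (a : R) x : order_ideal B -> B x -> B (a *: x).
Proof. by move=> [B0 Blin _] Bx; rewrite -[_ *: _]addr0; apply: Blin. Qed.

Lemma order_ideal_sum B (I : Type) (r : seq I) (F : I -> E) :
  order_ideal B -> (forall i, B (F i)) -> B (\sum_(i <- r) F i).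
Proof.
move=> [B0 Blin _] BF; apply: big_ind => // x y Bx By.
by rewrite -[x]scale1r; exact: Blin.
Qed.

(** If [x] is in [B] and [x i] is nonzero, solidity puts [unit_elt i] in [B]. Conversely [vabs x] is
    the supremum of its truncations, which are finite combinations of unit vectors of [B]. *)
Lemma bandE {B} : band B -> B = supp_band [set n | B (unit_elt n)].
Proof.
move=> [Bid Bsup]; have [B0 Blin Bsolid] := Bid; apply/seteqP; split=> x.
  move=> Bx i /= Bi; apply: contrapT => /eqP xi0; apply: Bi.
  rewrite -[unit_elt i]scale1r -(mulVf xi0) -scalerA; apply: order_idealZ => //.
  apply: Bsolid Bx _; apply/elt_leP => j; rewrite !vabsE eltZ unit_eltE.
  by case: eqP => [->|_]; rewrite ?mulr1// mulr0 normr0.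
move=> Ax; apply: (Bsolid (vabs x)); last first.
  by apply/elt_leP => i; rewrite !vabsE normr_id.
apply: (Bsup (range (fun n => restr `I_n (vabs x)))).
  move=> _ [n _ <-]; rewrite -sum_unit_elt; apply: order_ideal_sum => // i.
  have [Bi|/Ax xi0] := pselect (B (unit_elt i)); first exact: order_idealZ.
  by rewrite vabsE xi0 normr0 scale0r.
split.
  move=> _ [n _ <-]; apply/elt_leP => i; rewrite restrE vabsE.
  by case: ifP => // _.
move=> y uby; apply/elt_leP => i.
have /uby/elt_leP/(_ i) : range (fun n => restr `I_n (vabs x)) (restr `I_i.+1 (vabs x)).
  by exists i.+1.
by rewrite restrT//=.
Qed.

Lemma supp_band_set0 : supp_band set0 = [set 0].
Proof.
apply/seteqP; split => [x x0|x ->//]; apply: elt_ext => i; exact: x0.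
Qed.

Lemma supp_band_neq0 {A n} : A n -> supp_band A <> [set 0].
Proof.
by move=> /supp_band_unit + A0; rewrite A0 => /unit_elt_neq0.
Qed.

Lemma supp_band_sub {A A'} : A `<=` A' -> supp_band A `<=` supp_band A'.
Proof. by move=> AA' x Ax i A'i; apply: Ax => /AA'. Qed.

Lemma supp_band_inj : injective supp_band.
Proof.
suff sub A A' : supp_band A = supp_band A' -> A `<=` A'.
  by move=> A A' AA'; apply/seteqP; split; exact: sub.
by move=> AA' n /supp_band_unit; rewrite AA' => /supp_band_unitP.
Qed.

Lemma finite_dimensional_supp_band A :
  finite_set A -> finite_dimensional (supp_band A).
Proof.
move=> /finite_seqP[s As]; pose N := (\max_(i <- s) i).+1.
have AN : A `<=` `I_N.
  by move=> i; rewrite As /= => si; rewrite ltnS (@leq_bigmax_seq _ s xpredT id).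
(* Indices below [N] outside [A] contribute the zero vector, which keeps the spanning family inside
   the band. *)
exists N, (fun i => restr A (unit_elt i)); split=> [i j|x Ax]; first exact: restrF.
exists (fun i : 'I_N => x i).
transitivity (restr `I_N x).
  apply: elt_ext => i; have [/AN iN|Ai] := pselect (A i); first by rewrite restrT.
  by rewrite restrE Ax//; case: ifP.
rewrite -sum_unit_elt; apply: eq_bigr => i _; apply: elt_ext => j; rewrite !eltZ.
have [Aj|Aj] := pselect (A j); first by rewrite restrT.
rewrite restrF// unit_eltE; case: eqP => [ji|_]; last by rewrite mulr0.
by rewrite -ji Ax// !mul0r.
Qed.

(** * Band projections and convergence of block sums *)

Lemma restr_projection A : band_projection (supp_band A) (restr A).
Proof.
move=> x; split=> [i|y Ay]; first exact: restrF.
apply: elt_ext => i; rewrite elt_meetE !vabsE eltD eltN elt0.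
have [Ai|Ai] := pselect (A i).
  by rewrite restrT// subrr normr0 min_r.
by rewrite (Ay i Ai) normr0 min_l.
Qed.

Lemma sum_restr (A : nat -> set nat) x n : trivIset `I_n A ->
  \sum_(k < n) restr (A k) x = restr (\bigcup_(k < n) A k) x.
Proof.
move=> tA; apply: elt_ext => i; rewrite elt_sum.
have [[k kn Aki]|Ai] := pselect ((\bigcup_(k < n) A k) i); last first.
  rewrite restrF// big1// => k _; rewrite restrF// => Aki.
  by apply: Ai; exists k => /=.
rewrite restrT; last by exists k.
rewrite (bigD1 (Ordinal kn))// restrT// big1 => [|l lk]; first exact: addr0.
rewrite restrF// => Ali; case/eqP: lk; apply/val_inj/tA => //=.
by exists i.
Qed.

Lemma infimums_vanishing (z : nat -> E) : (forall n, ((0 : E) <= z n)%O) ->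
  (forall i, exists n, z n i = 0) -> infimums (range z) 0.
Proof.
move=> z0 zv; split=> [_ [n _ <-]//|y yz]; apply/elt_leP => i.
by have [n zn] := zv i; rewrite elt0 -zn; apply/elt_leP/yz; exists n.
Qed.

Lemma order_cvg_restr (A : nat -> set nat) x : trivIset setT A ->
  (forall i, exists k, A k i) ->
  order_cvg (series (fun k => restr (A k) x)) x.
Proof.
move=> tA covA.
(* The dominating sequence is the exact modulus of the error: [vabs x] on the indices that the first
   [n] blocks leave out. Each coordinate is eventually covered, so the infimum is 0. *)
exists (fun n => restr (~` \bigcup_(k < n) A k) (vabs x)); split; cbv beta.
- move=> m n mn; apply/elt_leP => i.
  have [[k km Aki]|Ai] := pselect ((\bigcup_(k < m) A k) i).
    by rewrite !restrF//; apply; exists k => //; exact: leq_trans mn.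
  rewrite [leRHS]restrT// restrE.
  by case: ifP => // _; rewrite vabsE.
- apply: infimums_vanishing => [n|i].
    by apply/elt_leP => i; rewrite elt0 restrE vabsE; case: ifP.
  have [k Aki] := covA i; exists k.+1; rewrite restrF//=.
  by apply; exists k => /=.
- move=> n; apply/elt_leP => i; rewrite vabsE eltD eltN.
  have -> : series (fun k => restr (A k) x) n = restr (\bigcup_(k < n) A k) x.
    by rewrite seriesEord; exact/sum_restr/sub_trivIset/tA.
  have [Ai|Ai] := pselect ((\bigcup_(k < n) A k) i).
    by rewrite restrT// subrr normr0 restrF//; apply.
  by rewrite restrF// sub0r normrN restrT// vabsE.
Qed.

(** The dominating sequence [z] is a decreasing net indexed by [nat], so its norms tend to 0, and
    solidity passes this on to the error. *)
Lemma order_cvg_norm (u : nat -> E) x :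
  order_continuous_norm E -> order_cvg u x -> u @ \oo --> x.
Proof.
move=> Eoc [z [zdec zinf zu]]; apply/cvgrPdist_lt => e e0.
have [||||N Nz] := Eoc nat leq z _ _ _ _ zdec zinf e e0.
- exact: inhabits 0%N.
- exact: leqnn.
- by move=> i j k; exact: leq_trans.
- by move=> i j; exists (maxn i j); rewrite leq_maxl leq_maxr.
exists N => // n /= /Nz; apply: le_lt_trans; rewrite distrC.
apply: le_elt_norm => i; have /elt_leP/(_ i) := zu n.
by rewrite vabsE => /le_trans; apply; exact: ler_norm.
Qed.

(** * Action of lattice automorphisms on atoms and coordinates *)

Lemma lattice_automorphism_le {T} x y :
  lattice_automorphism T -> (T x <= T y)%O = (x <= y)%O.
Proof.
move=> [_ /bij_inj Tinj TU _]; apply/idP/idP => /join_idPl xy; last first.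
  by rewrite -xy TU leUr.
by apply/join_idPl/Tinj; rewrite TU.
Qed.

Lemma linear_elt0 {T} : linear T -> T 0 = 0.
Proof.
by move=> Tlin; have := Tlin (-1) 0 0; rewrite scaler0 addr0 scaleN1r addNr.
Qed.

Lemma linear_eltZ {T} (a : R) x : linear T -> T (a *: x) = a *: T x.
Proof.
by move=> Tlin; have := Tlin a x 0; rewrite (linear_elt0 Tlin) !addr0.
Qed.

(* The image of an atom is an atom: the part of T e_n carried by a single
   coordinate pulls back below e_n. *)
Lemma lattice_automorphism_unit {T} n : lattice_automorphism T ->
  exists m, exists2 c, 0 < c & T (unit_elt n) = c *: unit_elt m.
Proof.
move=> Taut; have [Tlin Tbij _ _] := Taut.
have T0 := linear_elt0 Tlin.
set y := T (unit_elt n).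
have y0 i : 0 <= y i.
  suff /elt_leP : ((0 : E) <= y)%O by exact.
  rewrite -T0 lattice_automorphism_le//; apply/elt_leP => j.
  by rewrite unit_eltE ler0n.
have [m ym] : exists m, y m != 0.
  apply: contrapT => yv; apply: (unit_elt_neq0 n).
  apply: (bij_inj Tbij); rewrite T0; apply: elt_ext => i.
  by apply: contrapT => /eqP yi; apply: yv; exists i.
exists m; exists (y m); first by rewrite lt_def ym y0.
have [S _ TS] := Tbij; set w := S (y m *: unit_elt m).
have Tw : T w = y m *: unit_elt m by exact: TS.
have w0 : ((0 : E) <= w)%O.
  rewrite -(lattice_automorphism_le _ _ Taut) T0 Tw; apply/elt_leP => i.
  by rewrite eltZ mulr_ge0// unit_eltE ler0n.
have wn : (w <= unit_elt n)%O.
  rewrite -(lattice_automorphism_le _ _ Taut) Tw; apply/elt_leP => i.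
  by rewrite eltZ unit_eltE; case: eqP => [->|_]; rewrite ?mulr1 ?mulr0.
have wE : w = w n *: unit_elt n.
  apply: elt_ext => i; rewrite eltZ unit_eltE.
  case: eqP => [->|/eqP/negPf ni]; first by rewrite mulr1.
  rewrite mulr0; apply/eqP; rewrite eq_le; apply/andP; split.
    by have /elt_leP/(_ i) := wn; rewrite unit_eltE ni.
  by have /elt_leP/(_ i) := w0.
have TwE : y m *: unit_elt m = w n *: y by rewrite -Tw wE linear_eltZ// -wE.
(* At coordinate [m], [TwE] reads [y m = w n * y m] with [y m] nonzero. *)
have wn1 : w n = 1.
  have := congr1 (fun x : E => x m) TwE.
  rewrite !eltZ unit_eltE eqxx mulr1 => /esym; rewrite -[RHS]mul1r.
  by move/(mulIf ym).
by rewrite TwE wn1 scale1r.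
Qed.

(* x - x_n e_n is disjoint from e_n, hence its image is disjoint from e_m. *)
Lemma lattice_automorphism_coord {T n m} {c : R} x : lattice_automorphism T ->
  0 < c -> T (unit_elt n) = c *: unit_elt m -> T x m = c * x n.
Proof.
move=> [Tlin _ TU TI] c0 Tn.
set w : E := x - x n *: unit_elt n.
have -> : x = x n *: unit_elt n + w by rewrite addrC subrK.
have wn0 : w n = 0 by rewrite eltD eltN eltZ unit_eltE eqxx mulr1 subrr.
clearbody w; rewrite Tlin Tn !eltD !eltZ !unit_eltE !eqxx !mulr1 wn0 addr0.
suff -> : T w m = 0 by rewrite addr0 mulrC.
have Tabs : T (vabs w) = vabs (T w).
  by rewrite /vabs TU -scaleN1r linear_eltZ// scaleN1r.
have wn : (vabs w `&` unit_elt n)%O = 0.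
  apply: elt_ext => i; rewrite elt_meetE vabsE unit_eltE elt0.
  case: eqP => [->|_]; last by rewrite mulr0n min_r.
  by rewrite wn0 normr0 mulr1n min_l.
have := congr1 (fun z : E => T z m) wn.
rewrite TI Tabs Tn linear_elt0// elt_meetE vabsE eltZ unit_eltE eqxx mulr1 elt0.
by case: leP => [_ /eqP|_ c00]; [rewrite normr_eq0 => /eqP|rewrite c00 ltxx in c0].
Qed.

(** If [y m = 0], then [x - y] has [m]-th coordinate [x m], hence norm at least the modulus of
    [x m]. *)
Lemma open_coord_neq0 m : open [set x : E | x m != 0].
Proof.
rewrite openE => x /= xm; apply/nbhs_ballP; exists `|x m|; rewrite /= ?normr_gt0//.
move=> y; rewrite -ball_normE /= => xy; apply/eqP => ym.
have := le_lt_trans (coord_le_norm (x - y) m) xy.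
by rewrite eltD eltN ym subr0 ltxx.
Qed.

End coordinates.

(** * Enumeration of the classes of a partition of the natural numbers *)

Lemma countable_classes (C : nat -> set nat) :
  (forall n, C n n) -> (forall n m, C n m -> C m = C n) ->
  exists (alpha : option nat) (r : nat -> nat),
    [/\ alpha <> Some 0%N, trivIset (below alpha) (C \o r)
      & forall i, exists2 k, below alpha k & C (r k) i].
Proof.
(* Each class is represented by its least element. The set [S] of these is countable; whether it is
   finite decides [alpha]. *)
move=> Cxx Ceq; pose S := [set n | forall m, C n m -> (n <= m)%N].
have repr i : exists2 n, S n & C n i.
  have exC : exists m, `[< C i m >] by exists i; apply/asboolP.
  case: (ex_minnP exC) => n /asboolP Cin nmin.
  exists n; last by rewrite (Ceq i).
  by move=> m; rewrite (Ceq i)// => Cim; apply/nmin/asboolP.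
have Sinj n m i : S n -> S m -> C n i -> C m i -> n = m.
  move=> Sn Sm Cni Cmi; have Cnm : C n = C m by rewrite -(Ceq _ _ Cni) (Ceq _ _ Cmi).
  by apply/eqP; rewrite eqn_leq Sn ?Sm// -?Cnm// Cnm.
have [alpha [r [rS rinj rsurj]]] : exists alpha r, set_bij (below alpha) S r.
  have [/finite_setP[a]|Sinf] := pselect (finite_set S).
    by move=> /card_esym/card_set_bijP[r rbij]; exists (Some a), r.
  have /card_esym/card_set_bijP[r [rS rinj rsurj]] :=
    eq_card_nat (countableP S) Sinf.
  exists None, r; split => [k _|k l _ _|n /rsurj[k _ <-]].
  - exact: rS.
  - by apply: rinj; rewrite in_setT.
  - by exists k.
exists alpha, r; split => [a0|k l ak al [i [Cki Cli]]|i].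
(* The class containing 0 shows that there is at least one class. *)
- by have [n /rsurj[k +]] := repr 0%N; rewrite a0.
- by apply: rinj; rewrite ?inE//; exact: Sinj (rS _ ak) (rS _ al) Cki Cli.
- by have [n /rsurj[k ak <-] Cni] := repr i; exists k.
Qed.

(** * Orbits of the induced action and invariant bands *)

Section orbits.
Context {R : realType} {E : symSeqSpace R} {G : groupType} (rho : G -> E -> E).
Hypothesis rho_rep : positive_representation rho.

(** The orbit of [n] under the permutation action on coordinates. Existentially quantifying the
    weight [c] avoids constructing the permutations. *)
Definition orb n : set nat :=
  [set m | exists s, exists2 c : R, 0 < c &
    rho s (unit_elt n) = c *: unit_elt m].

Let rho_aut s : lattice_automorphism (rho s). Proof. exact: rho_rep.1. Qed.

Let rhoZ s (a : R) x : rho s (a *: x) = a *: rho s x.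
Proof. by apply: linear_eltZ; have [] := rho_aut s. Qed.

(** Multiplicativity makes [rho 1%g] idempotent, and an injective idempotent map is the identity. *)
Let rho1 x : rho 1%g x = x.
Proof.
have [_ /bij_inj inj1 _ _] := rho_aut 1%g; apply: inj1.
by rewrite -[in RHS](mulg1 1%g) rho_rep.2.
Qed.

Let rhoK s : cancel (rho s) (rho s^-1%g).
Proof. by move=> x; rewrite -[LHS](congr1 (@^~ x) (rho_rep.2 _ _)) mulVg rho1. Qed.

Let rho_unitV {s n m} {c : R} : 0 < c ->
  rho s (unit_elt n) = c *: unit_elt m ->
  rho s^-1%g (unit_elt m) = c^-1 *: unit_elt n.
Proof.
move=> c0 snm; rewrite -(rhoK s (unit_elt n)) snm rhoZ scalerA mulVf ?scale1r//.
exact: lt0r_neq0.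
Qed.

Lemma orb_refl n : orb n n.
Proof. by exists 1%g, 1 => //; rewrite rho1 scale1r. Qed.

Lemma orb_sym {n m} : orb n m -> orb m n.
Proof.
move=> [s [c c0 snm]]; exists s^-1%g, c^-1; first by rewrite invr_gt0.
exact: rho_unitV.
Qed.

Lemma orb_trans {n m k} : orb n m -> orb m k -> orb n k.
Proof.
move=> [s [c c0 snm]] [t [d d0 tmk]]; exists (t * s)%g, (c * d).
  exact: mulr_gt0.
by rewrite rho_rep.2 /= snm rhoZ tmk scalerA.
Qed.

Lemma orb_eq {n m} : orb n m -> orb m = orb n.
Proof.
move=> nm; apply/seteqP; split => k; first exact: orb_trans.
exact/orb_trans/orb_sym.
Qed.

Lemma invariant_supp_band {A} :
  invariant_band rho (supp_band A) <-> forall n, A n -> orb n `<=` A.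
Proof.
split=> [[_ inv] n /supp_band_unit/inv An m [s [c c0 snm]]|Aorb].
  apply: contrapT => /(An s) /eqP.
  by rewrite snm eltZ unit_eltE eqxx mulr1 gt_eqF.
split; first exact: band_supp_band.
move=> s x Ax j Aj.
(* Pulling [j] back along [s] gives an index [i] whose orbit contains [j], so [i] is outside [A];
   coordinate [j] of [rho s x] is a multiple of [x i], which is 0. *)
have [i [c c0 sji]] := lattice_automorphism_unit j (rho_aut s^-1%g).
have /= := rho_unitV c0 sji; rewrite invgK => sij.
have cV0 : 0 < c^-1 by rewrite invr_gt0.
rewrite (lattice_automorphism_coord x (rho_aut s) cV0 sij) Ax ?mulr0// => Ai.
by apply: Aj; apply: Aorb Ai _ _; exists s, c^-1.
Qed.

(** Invariant bands correspond to sets closed under orbits, and the minimal nonempty ones among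
    these are the single orbits. *)
Lemma band_irreducible_orbP B :
  band_irreducible rho B <-> exists n, B = supp_band (orb n).
Proof.
have orb_inv n : invariant_band rho (supp_band (orb n)).
  by apply/invariant_supp_band => m /orb_eq ->.
split=> [[Binv B0 Birr]|[n ->]].
  have BE := bandE Binv.1; set A := [set n | _] in BE.
  have Aorb n : A n -> orb n `<=` A.
    by move: n; apply/invariant_supp_band; rewrite -BE.
  have [[n An]|A0] := pselect (A !=set0); last first.
    exfalso; apply: B0; rewrite BE -supp_band_set0; congr supp_band.
    by apply/seteqP; split=> // n An; apply: A0; exists n.
  (* The orbit of a single point of [A] spans a nonzero invariant band inside [B], so irreducibility
     makes it all of [B]. *)
  exists n; have [| |<-//] := Birr _ (orb_inv n).
    by rewrite BE; exact/supp_band_sub/Aorb.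
  by move/(supp_band_neq0 (orb_refl n)).
split; [exact: orb_inv|exact: supp_band_neq0 (orb_refl n)|].
move=> B' B'inv; rewrite (bandE B'inv.1); set A := [set n | _].
move=> AB; have [[m Am]|A0] := pselect (A !=set0).
  right; congr supp_band; apply/seteqP; split=> k.
    by move=> /(@supp_band_unit _ E)/AB/supp_band_unitP.
  (* The point [m] of [A] has the same orbit as [n], and [A] contains the orbit of each of its
     points. *)
  have nm : orb n m by apply/(@supp_band_unitP _ E)/AB/supp_band_unit.
  rewrite -(orb_eq nm); move: k; move: m Am {nm}; apply/invariant_supp_band.
  by rewrite -(bandE B'inv.1).
left; rewrite -supp_band_set0; congr supp_band.
by apply/seteqP; split=> // k Ak; apply: A0; exists k.
Qed.

(* Each rho s e_n lies in exactly one of the open sets {x | x_m <> 0}. *)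
Lemma finite_orb n : sot_compact_image rho -> finite_set (orb n).
Proof.
move=> cpt.
(* Evaluation at [unit_elt n] is continuous for pointwise convergence, so the set of all
   [rho s (unit_elt n)] is compact in norm. *)
pose ev (T : {ptws E -> E}) : E := T (unit_elt n).
have : compact (ev @` range rho).
  apply: continuous_compact cpt; apply: continuous_subspaceT.
  exact: (@proj_continuous E (fun=> E) (unit_elt n)).
rewrite compact_cover => /(_ nat setT (fun m => [set x : E | x m != 0]))[].
- by move=> m _; exact: open_coord_neq0.
- move=> _ [_ [s _ <-] <-].
  have [m [c c0 snm]] := lattice_automorphism_unit n (rho_aut s).
  by exists m => //=; rewrite /ev snm eltZ unit_eltE eqxx mulr1 gt_eqF.
(* The finite set [D] indexing a subcover contains the orbit: a positive multiple of [unit_elt m] is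
   covered only by the open set of index [m]. *)
move=> D _ Dcov; apply: sub_finite_set (finite_fset D) => m [s [c c0 snm]].
have [k Dk] : cover [set` D] (fun m => [set x : E | x m != 0]) (rho s (unit_elt n)).
  by apply: Dcov; exists (rho s) => //; exists s.
rewrite /= snm eltZ unit_eltE; have [<-//|_] := eqVneq k m.
by rewrite mulr0 eqxx.
Qed.

End orbits.

(** * Decomposition of the space along the orbits *)

Theorem theorem5p7 (R : realType) (E : symSeqSpace R) (G : groupType)
    (rho : G -> E -> E) (rho_rep : positive_representation rho) :
  exists (alpha : option nat) (B : nat -> set E) (P : nat -> E -> E),
    [/\ alpha <> Some 0%N,
        set_inj (below alpha) B,
        [set B' | band_irreducible rho B'] = B @` below alpha
      & forall n, below alpha n -> band_projection (B n) (P n)] /\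
    [/\ forall x : E,
          match alpha with
          | Some a => x = \sum_(n < a) P n x
          | None => unconditionally_order_cvg (fun n => P n x) x
          end,
        order_continuous_norm E ->
          forall x : E,
          match alpha with
          | Some a => x = \sum_(n < a) P n x
          | None => unconditionally_cvg (fun n => P n x) x
          end
      & sot_compact_image rho ->
          order_continuous_norm E \/ is_ellinfty E ->
          (forall B' : set E, band_irreducible rho B' -> finite_dimensional B')
          /\ alpha = None].
Proof.
have [alpha [r [alpha0 tr cov]]] :=
  countable_classes (orb rho) (orb_refl rho rho_rep) (@orb_eq _ _ _ _ rho_rep).
(* A permuted family of orbits is again a partition, so every rearranged series is itself a series
   of block restrictions. *)
have tr_bij (s : nat -> nat) : alpha = None -> bijective s ->
    trivIset setT (orb rho \o r \o s).
  move=> aN /bij_inj sinj k l _ _ kl; apply/sinj/tr => //; by rewrite aN.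
have cov_bij (s : nat -> nat) : alpha = None -> bijective s ->
    forall i, exists k, (orb rho \o r \o s) k i.
  move=> aN [t st ts] i; have [k _ ki] := cov i.
  by exists (t k); rewrite /= ts.
(* With finitely many orbits, the sum is the restriction of [x] to their union, which is
   everything. *)
have fin_sum (x : E) : if alpha is Some a then
    x = \sum_(n < a) restr (orb rho (r n)) x else True.
  case: alpha tr cov {alpha0 tr_bij cov_bij} => [a|//] tr cov.
  rewrite (sum_restr _ _ _ tr); apply: elt_ext => i.
  by have [k ka ki] := cov i; rewrite restrT//; exists k.
exists alpha, (fun n => supp_band (orb rho (r n))), (fun n => restr (orb rho (r n))).
split; split=> //.
- move=> k l; rewrite !inE => ak al /supp_band_inj kl.
  by apply: tr => //; exists (r k); split; rewrite /= -?kl; exact: orb_refl.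
- apply/seteqP; split=> [B /(band_irreducible_orbP rho rho_rep)[n ->]|_ [k _ <-]] /=.
    have [k ak kn] := cov n; exists k => //.
    by rewrite (orb_eq rho rho_rep kn).
  by apply/(band_irreducible_orbP rho rho_rep); exists (r k).
- by move=> n _; exact: restr_projection.
- move=> x; case: alpha tr_bij cov_bij fin_sum {tr cov alpha0} => [a _ _ /(_ x)//|].
  move=> tr_bij cov_bij _ s sbij.
  exact: order_cvg_restr (tr_bij s erefl sbij) (cov_bij s erefl sbij).
- move=> Eoc x; case: alpha tr_bij cov_bij fin_sum {tr cov alpha0} => [a _ _ /(_ x)//|].
  move=> tr_bij cov_bij _ s sbij; apply: order_cvg_norm Eoc _.
  exact: order_cvg_restr (tr_bij s erefl sbij) (cov_bij s erefl sbij).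
- move=> cpt _; split=> [B /(band_irreducible_orbP rho rho_rep)[n ->]|].
    exact/finite_dimensional_supp_band/finite_orb.
  case: alpha cov {alpha0 tr tr_bij cov_bij fin_sum} => [a|//] cov.
  (* Finitely many finite orbits cannot cover [nat]. *)
  exfalso; apply: infinite_nat.
  apply: sub_finite_set (bigcup_finite (finite_II a) _); last first.
    by move=> k _; exact: (finite_orb rho rho_rep (r k) cpt).
  by move=> i _; have [k ka ki] := cov i; exists k.
Qed.
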